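(* Consider a parametric family of convex programs $(\mathcal{K}_t, c_t)_{t>1}$ in $\mathbb{R}^n$ with $\vartheta$-self-concordant barriers $(f_t)_{t>1}$ and central paths $(\mathcal{C}_t)_{t>1}$, satisfying assumptions (i), (ii), (iii) of the context, and let $\mathsf{C}$ be its tropical central path. Then the family of functions $(\lambda \mapsto \log_t \mathcal{C}_t(t^\lambda))_t$ converges uniformly on $\mathbb{R}$ to the map $\lambda \mapsto \mathsf{C}(\lambda)$ as $t\to\infty$. More precisely, there exist constants $\Gamma>0$ and $t_0>0$ such that for all $t>1$ with $t\geq t_0$ and for all $\lambda \in \mathbb{R}$, $$d_\infty\big(\log_t \mathcal{C}_t(t^\lambda), \mathsf{C}(\lambda)\big) \leq \frac{\Gamma}{\log t}.$$ Moreover, the constant $\Gamma$ depends only on $\vartheta$, $n$, $\delta^*$ and on $\mathsf{K}$.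
   Context: Notation: $\mathbb{T} := \mathbb{R}\cup\{-\infty\}$ (with the order topology; $\mathbb{T}^n$ with the product topology), $\log_t(\cdot) := \log(\cdot)/\log t$ applied entrywise, with $\log_t 0 := -\infty$; $e$ is the all-ones vector; inequalities between vectors are entrywise. For $u,v \in \mathbb{T}^n$, $d_\infty(u,v) := \inf\{\lambda \geq 0 : u-\lambda e \leq v \leq u+\lambda e\}$, and for closed sets $U,V$, $d_\infty(U,V) := \max(\sup_{u\in U}\inf_{v \in V} d_\infty(u,v), \sup_{v \in V}\inf_{u\in U} d_\infty(u,v))$. For $x,y \in \mathbb{T}^n$, $\langle x,y\rangle_{\mathbb{T}} := \max_i(x_i+y_i)$. Self-concordant barriers: let $f$ be a $C^2$ real-valued function on an open convex set $D_f \subset \mathbb{R}^n$, with gradient $g(x)$ and positive definite Hessian $H(x)$. Put $\|v\|_x := \sqrt{v^\top H(x) v}$ and $B_x(y,r) := \{z : \|y-z\|_x < r\}$. The function $f$ is (strongly nondegenerate) self-concordant if for all $x \in D_f$ we have $B_x(x,1) \subset D_f$ and, for all $y \in B_x(x,1)$ and $v \neq 0$, $1-\|y-x\|_x \leq \|v\|_y/\|v\|_x \leq 1/(1-\|y-x\|_x)$. It is a $\vartheta$-self-concordant barrier over $D_f$ if moreover $\sup_{x \in D_f} \|H(x)^{-1}g(x)\|_x^2 \leq \vartheta$. Setting: for every $t>1$, $\mathcal{K}_t \subset \mathbb{R}^n_{\geq 0}$ is a closed convex set with nonempty interior and $0 \in \mathcal{K}_t$, $c_t \in \mathbb{R}^n_{\geq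 0}$, and $f_t$ is a $\vartheta$-self-concordant barrier over $\operatorname{int}\mathcal{K}_t$, with $\vartheta$ independent of $t$. For $\eta>0$, $\mathcal{C}_t(\eta)$ is the unique minimizer (assumed to exist) of $\eta\langle c_t,x\rangle + f_t(x)$ over $x \in \operatorname{int}\mathcal{K}_t$; $\eta\mapsto\mathcal{C}_t(\eta)$ is the central path. Assumptions: there exist $\mathsf{K} \subset \mathbb{T}^n$ and $\mathsf{c} \in \mathbb{T}^n$ such that (i) $d_\infty(\log_t \mathcal{K}_t, \mathsf{K}) = O(1/\log t)$ and $d_\infty(\log_t c_t,\mathsf{c}) = O(1/\log t)$; (ii) $\mathsf{K}$ is regular, i.e. equal to the closure of its interior; (iii) $\mathsf{K}\cap\mathbb{R}^n$ is semilinear, i.e. a finite union of polyhedra. The constant $\delta^*>0$ is such that $\delta^* \geq \max\big(d_\infty(\log_t\mathcal{K}_t,\mathsf{K}), d_\infty(\log_t c_t,\mathsf{c})\big)\log t$ for all $t>1$. Tropical central path: for $\lambda \in \mathbb{R}$, $\mathsf{C}(\lambda)$ is the tropical barycenter, i.e. the entrywise supremum, of the set $\mathsf{K}_\lambda := \{x \in \mathsf{K} : \langle \mathsf{c},x\rangle_{\mathbb{T}} \leq -\lambda\}$ (these sets are assumed to be bounded from above, so that the supremum is well defined). *)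

(* Defs.v *)
From HB Require Import structures.
From mathcomp Require Import all_boot all_order all_algebra.
From mathcomp Require Import all_classical all_reals all_analysis.
Import Order.TTheory GRing.Theory Num.Theory.
Import numFieldNormedType.Exports.

Set Implicit Arguments.
Unset Strict Implicit.
Unset Printing Implicit Defensive.

Local Open Scope classical_set_scope.
Local Open Scope ring_scope.

Section Tropical.
Context {R : realType} {n : nat}.
Implicit Types (u v x y : 'cV[\bar R]_n) (U V K : set 'cV[\bar R]_n).

(* T^n, where T = R U {-oo}, is encoded as the set of vectors of \bar R with no
   entry +oo.  It is open in \bar R^n, whose matrix topology is the product of
   the order topologies. *)
Definition tropical_space : set 'cV[\bar R]_n :=
  [set x : 'cV[\bar R]_n | forall i, (x i ord0 < +oo)%E].

Definition dinf u v : \bar R :=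
  ereal_inf [set l%:E | l in [set l : R | 0 <= l /\
    forall i, (u i ord0 - l%:E <= v i ord0)%E /\ (v i ord0 <= u i ord0 + l%:E)%E]].

Definition dinf_set U V : \bar R :=
  maxe (ereal_sup [set ereal_inf [set dinf u v | v in V] | u in U])
       (ereal_sup [set ereal_inf [set dinf u v | u in U] | v in V]).

Definition tropical_dot x y : \bar R :=
  \big[maxe/-oo%E]_(i < n) (x i ord0 + y i ord0)%E.

Definition tropical_barycenter U : 'cV[\bar R]_n :=
  \col_i ereal_sup [set x i ord0 | x in U].

(* [lne] is the extended logarithm, with [lne 0 = -oo]; it is only used here on
   nonnegative entries, and for t > 1. *)
Definition logt (t : R) (x : 'cV[R]_n) : 'cV[\bar R]_n :=
  \col_i (lne (x i ord0)%:E * ((ln t)^-1)%:E)%E.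

(* Interior and closure are those of T^n: as T^n is open in \bar R^n, only the
   closure has to be intersected with it. *)
Definition tropical_regular K : Prop :=
  K = tropical_space `&` closure K°.

Definition real_part K : set 'cV[R]_n :=
  [set x : 'cV[R]_n | K (map_mx EFin x)].

Definition polyhedron (P : set 'cV[R]_n) : Prop :=
  exists (m : nat) (A : 'M[R]_(m, n)) (b : 'cV[R]_m),
    P = [set x : 'cV[R]_n | forall i, (A *m x) i ord0 <= b i ord0].

Definition semilinear_set (S : set 'cV[R]_n) : Prop :=
  exists (k : nat) (P : 'I_k -> set 'cV[R]_n),
    (forall j, polyhedron (P j)) /\ S = \bigcup_(j in [set: 'I_k]) P j.

Definition tropical_sublevel K (c : 'cV[\bar R]_n) (lambda : R) :
    set 'cV[\bar R]_n :=
  [set x : 'cV[\bar R]_n | K x /\ (tropical_dot c x <= (- lambda)%:E)%E].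

Definition bounded_from_above U : Prop :=
  exists M : R, forall x, U x -> forall i, (x i ord0 <= M%:E)%E.

Definition tropical_central_path K (c : 'cV[\bar R]_n) (lambda : R) :
    'cV[\bar R]_n :=
  tropical_barycenter (tropical_sublevel K c lambda).

End Tropical.

(* F t = O(1 / log t) as t -> +oo, for F with values in [0, +oo]; in particular
   F t is finite for t large. *)
Definition bigO_inv_log {R : realType} (F : R -> \bar R) : Prop :=
  exists M : R, \forall t \near +oo, (F t <= (M / ln t)%:E)%E.

Section SelfConcordant.
Context {R : realType} {n : nat}.
Implicit Types (f : 'cV[R]_n -> R) (D : set 'cV[R]_n) (x y z v c : 'cV[R]_n).

Definition nonneg_orthant : set 'cV[R]_n :=
  [set x : 'cV[R]_n | forall i, 0 <= x i ord0].

Definition dotv c x : R := \sum_(i < n) c i ord0 * x i ord0.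

Definition gradient f x : 'cV[R]_n :=
  \col_i 'D_(delta_mx i ord0 : 'cV[R]_n) f x.

Definition hessian f x : 'M[R]_n :=
  \matrix_(i, j) 'D_(delta_mx i ord0 : 'cV[R]_n) (fun y => gradient f y j ord0) x.

(* Meant for D open, so that the derivatives at points of D do not depend on
   the values of f outside D. *)
Definition C2_on f D : Prop :=
  [/\ forall x, D x -> differentiable f x,
      forall x, D x -> differentiable (gradient f) x
    & forall x, D x -> {for x, continuous (hessian f)}].

Definition posdef (A : 'M[R]_n) : Prop :=
  A^T = A /\ forall v, v != 0 -> 0 < (v^T *m A *m v) ord0 ord0.

Definition local_norm f x v : R :=
  Num.sqrt ((v^T *m hessian f x *m v) ord0 ord0).

Definition local_ball f x y (r : R) : set 'cV[R]_n :=
  [set z | local_norm f x (y - z) < r].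

Definition self_concordant f D : Prop :=
  [/\ open D, convex_set D, C2_on f D,
      forall x, D x -> posdef (hessian f x)
    & forall x, D x ->
        local_ball f x x 1 `<=` D /\
        forall y v, local_ball f x x 1 y -> v != 0 ->
          1 - local_norm f x (y - x) <= local_norm f y v / local_norm f x v
            <= (1 - local_norm f x (y - x))^-1].

Definition sc_barrier (theta : R) f D : Prop :=
  self_concordant f D /\
  (ereal_sup [set ((local_norm f x (invmx (hessian f x) *m gradient f x)) ^+ 2)%:E
             | x in D] <= theta%:E)%E.

Definition minimizer (phi : 'cV[R]_n -> R) D x : Prop :=
  D x /\ forall y, D y -> phi x <= phi y.

Definition unique_minimizer (phi : 'cV[R]_n -> R) D x : Prop :=
  minimizer phi D x /\ forall y, minimizer phi D y -> y = x.

(* C is only specified for t > 1 and eta > 0. *)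
Definition central_path (Kt : R -> set 'cV[R]_n) (ct : R -> 'cV[R]_n)
    (ft : R -> 'cV[R]_n -> R) (C : R -> R -> 'cV[R]_n) : Prop :=
  forall t eta : R, 1 < t -> 0 < eta ->
    unique_minimizer (fun x => eta * dotv (ct t) x + ft t x)
      (Kt t)° (C t eta).

(* The parametric family of convex programs, for t > 1. *)
Definition convex_programs (Kt : R -> set 'cV[R]_n) (ct : R -> 'cV[R]_n) :
    Prop :=
  forall t : R, 1 < t ->
    [/\ closed (Kt t), convex_set (Kt t), (Kt t)° !=set0, Kt t 0
      & Kt t `<=` nonneg_orthant /\ nonneg_orthant (ct t)].

End SelfConcordant.

(* Main.v *)
Require Import Defs.
From HB Require Import structures.
From mathcomp Require Import all_boot all_order all_algebra.
From mathcomp Require Import all_classical all_reals all_analysis.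
From mathcomp Require Import ring lra.
Import Order.TTheory GRing.Theory Num.Theory.
Import numFieldNormedType.Exports.
Local Open Scope classical_set_scope.
Local Open Scope ring_scope.

Set Implicit Arguments.
Unset Strict Implicit.
Unset Printing Implicit Defensive.

(* Two facts about a barrier minimizer x of eta <c, .> + f over K, where
   0 \in K and K, c lie in the nonnegative orthant, control the central path up
   to multiplicative constants:
   - comparing x with 0 gives <c, x> <= 2 theta / eta;
   - every y in K with <c, y> <= 1 / eta satisfies y <= A x entrywise, with A
     depending only on theta: the barrier bounds the local norm of y - x, so the
     Dikin ellipsoid at x contains x - s (y - x) for some s = s(theta) > 0, and
     this point is still in the nonnegative orthant.
   Since K_t contains 0 and is convex, it is stable under multiplication by
   scalars in [0, 1]; after multiplying by a constant factor, points of log_t K_t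
   and of K can thus be exchanged while keeping the sublevel constraint, and all
   constants become O(1 / log t) after applying log_t. *)

(** * Bilinear forms and positive definite matrices *)

Definition bform {R : realType} {n : nat} (A : 'M[R]_n) (u v : 'cV[R]_n) : R :=
  (u^T *m A *m v) ord0 ord0.

Section LinearAlgebra.
Context {R : realType} {n : nat}.
Implicit Types (A : 'M[R]_n) (u v w : 'cV[R]_n) (a : R).

Lemma dotvE u v : dotv u v = (u^T *m v) ord0 ord0.
Proof. by rewrite mxE; apply: eq_bigr => i _; rewrite mxE. Qed.

Lemma dotvD u v w : dotv u (v + w) = dotv u v + dotv u w.
Proof. by rewrite !dotvE mulmxDr mxE. Qed.

Lemma dotvN u v : dotv u (- v) = - dotv u v.
Proof. by rewrite !dotvE mulmxN mxE. Qed.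

Lemma dotvZ a u v : dotv u (a *: v) = a * dotv u v.
Proof. by rewrite !dotvE -scalemxAr mxE. Qed.

Lemma dotv_ge0 u v : nonneg_orthant u -> nonneg_orthant v -> 0 <= dotv u v.
Proof. by move=> u0 v0; apply: sumr_ge0 => i _; rewrite mulr_ge0. Qed.

Lemma bformZ A a v : bform A (a *: v) (a *: v) = a ^+ 2 * bform A v v.
Proof.
have aT : (a *: v)^T = a *: v^T by rewrite linearZ.
rewrite /bform aT -!scalemxAl -scalemxAr.
by rewrite scalerA mxE expr2.
Qed.

Lemma bformC A u v : A^T = A -> bform A u v = bform A v u.
Proof.
move=> As; rewrite /bform -(trmxK (_ *m v)) [LHS]mxE !trmx_mul trmxK As.
by rewrite mulmxA.
Qed.

Lemma posdef_ge0 A v : posdef A -> 0 <= bform A v v.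
Proof.
move=> [_ Apos]; have [->|v0] := eqVneq v 0; last exact/ltW/Apos.
by rewrite /bform mulmx0 mxE.
Qed.

Lemma posdef_cauchy_schwarz A u v : posdef A ->
  bform A u v ^+ 2 <= bform A u u * bform A v v.
Proof.
move=> Apd; have [->|v0] := eqVneq v 0.
  by rewrite /bform !mulmx0 !mxE mulr0 expr0n.
have vv0 : 0 < bform A v v by case: Apd => _; apply.
(* This [s] minimizes the quadratic form along the line [u + s *: v]; its nonnegativity at the
   minimum is the inequality. *)
set s := - (bform A u v / bform A v v).
have := posdef_ge0 (u + s *: v) Apd.
have -> : bform A (u + s *: v) (u + s *: v) =
    bform A u u + s * bform A u v + s * bform A v u + s ^+ 2 * bform A v v.
  have uT : (u + s *: v)^T = u^T + s *: v^T by rewrite linearD linearZ.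
  rewrite /bform uT !mulmxDl !mulmxDr -!scalemxAl -!scalemxAr.
  by rewrite !mxE; ring.
rewrite (@bformC A v u); last by case: Apd.
have -> : bform A u u + s * bform A u v + s * bform A u v + s ^+ 2 * bform A v v
   = bform A u u - bform A u v ^+ 2 / bform A v v.
  by rewrite /s; field; rewrite gt_eqF.
by rewrite subr_ge0 ler_pdivrMr.
Qed.

Lemma posdef_unitmx A : posdef A -> A \in unitmx.
Proof.
move=> [_ Apos]; rewrite unitmxE unitfE; apply/negP => /det0P[v v0 vA].
have vT0 : v^T != 0 by rewrite trmx_eq0.
by have := Apos _ vT0; rewrite trmxK vA mul0mx mxE ltxx.
Qed.

End LinearAlgebra.

(** * Derivatives along lines and first-order optimality *)

Section LineDerivatives.
Context {R : realType} {n : nat}.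
Implicit Types (f : 'cV[R]_n -> R) (D : set 'cV[R]_n) (x d : 'cV[R]_n).

(** Both derivatives are limits of the same difference quotient. *)
Lemma is_derive_line (F : 'cV[R]_n -> R) x d (s l : R) :
  is_derive (x + s *: d) d F l -> is_derive s 1 (fun r => F (x + r *: d)) l.
Proof.
have E : (fun h : R => h^-1 *: (((fun r => F (x + r *: d)) \o shift s) (h *: (1 : R))
      - F (x + s *: d))) =
    (fun h => h^-1 *: ((F \o shift (x + s *: d)) (h *: d) - F (x + s *: d))).
  apply/funext => h /=; congr (_ *: (F _ - _)).
  by rewrite [h *: _]mulr1 scalerDl addrCA.
by case=> der dl; split; [rewrite /derivable E | rewrite /derive E].
Qed.

Lemma derive_coord_sum (F : 'cV[R]_n -> R) x d : differentiable F x ->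
  'D_d F x = \sum_(i < n) d i ord0 * 'D_(delta_mx i ord0 : 'cV[R]_n) F x.
Proof.
move=> dF; rewrite deriveE// [in LHS](matrix_sum_delta d) linear_sum.
apply: eq_bigr => i _; rewrite big_ord1 linearZ deriveE//.
Qed.

Lemma is_derive_gradient_line f D x d (s : R) :
  C2_on f D -> D (x + s *: d) ->
  is_derive s 1 (fun r => dotv (gradient f (x + r *: d)) d)
    (bform (hessian f (x + s *: d)) d d).
Proof.
move=> [_ dg _] Dz; set z := x + s *: d in Dz *.
apply: (@is_derive_line (fun y => dotv (gradient f y) d)); rewrite -/z.
have dgj j : differentiable (fun y => gradient f y j ord0) z.
  apply: (@differentiable_comp _ _ _ _ (gradient f) (fun N : 'cV[R]_n => N j ord0 : R)).
    exact: dg.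
  exact: differentiable_coord.
have -> : (fun y => dotv (gradient f y) d) =
    \sum_(j < n) (d j ord0 \*: (fun y => gradient f y j ord0)).
  apply/funext => y; rewrite fct_sumE; apply: eq_bigr => j _.
  by rewrite mulrC.
have -> : bform (hessian f z) d d =
    \sum_(j < n) d j ord0 *: 'D_d (fun y => gradient f y j ord0) z.
  rewrite /bform mxE; apply: eq_bigr => j _; rewrite mulrC; congr (_ * _).
  rewrite derive_coord_sum// mxE; apply: eq_bigr => i _.
  by rewrite !mxE.
apply: is_derive_sum => j; apply: is_deriveZ; split => //.
exact: diff_derivable.
Qed.

(** Fermat's rule for the objective restricted to the line through [x] in direction [d], which stays
    in the open set [D] near [x]. *)
Lemma interior_minimizer_gradient f D (a : R) (c x : 'cV[R]_n) :
  open D -> C2_on f D -> minimizer (fun y => a * dotv c y + f y) D x ->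
  forall d, dotv (gradient f x) d = - (a * dotv c d).
Proof.
move=> oD [df _ _] [Dx xmin] d.
pose phi (r : R) := a * dotv c (x + r *: d) + f (x + r *: d).
have cline : {for 0, continuous (fun r : R => x + r *: d)}.
  by apply: cvgD; [exact: cvg_cst|apply: cvgZr_tmp; exact: cvg_id].
have /nbhs_ballP[e /= e0 De] : nbhs (0 : R) [set r | D (x + r *: d)].
  by apply: cline; rewrite /= scale0r addr0; exact: open_nbhs_nbhs.
have dline r : D (x + r *: d) ->
    is_derive r 1 phi (a * dotv c d + 'D_d f (x + r *: d)).
  move=> Dr; apply: is_deriveD.
    have -> : (fun r => a * dotv c (x + r *: d)) =
        (fun r => a * dotv c x) + (a * dotv c d) \*: id.
      apply/funext => q; rewrite dotvD dotvZ.
      by rewrite fctE /= [_ *: _]mulrAC; ring.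
    rewrite -[X in is_derive _ _ _ X]add0r.
    apply: is_deriveD. 
    rewrite -[X in is_derive _ _ _ X]mulr1; exact: is_deriveZ.
  apply: is_derive_line; split => //; apply: diff_derivable; exact: df.
have De' r : r \in `]-e, e[ -> D (x + r *: d).
  rewrite in_itv/= => re; apply: De; rewrite /ball/= sub0r normrN.
  by rewrite ltr_norml.
have He : 0 \in `](- e), e[ by rewrite in_itv/= oppr_lt0 e0.
have phi0 : is_derive (0 : R) (1 : R) phi 0.
  apply: (@derive1_at_min R phi (- e) e 0) => //.
  - by rewrite ge0_cp// ltW.
  - by move=> r /De' /dline[].
  - by move=> r /De' Dr; rewrite /phi !scale0r addr0; exact: xmin.
have dphi := dline 0 (De' 0 He).
have := @derive_val _ _ _ _ _ _ _ phi0; rewrite (@derive_val _ _ _ _ _ _ _ dphi).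
rewrite scale0r addr0 derive_coord_sum; last exact: df.
have -> : \sum_(i < n) d i ord0 * 'D_(delta_mx i ord0 : 'cV[R]_n) f x =
    dotv (gradient f x) d.
  by apply: eq_bigr => i _; rewrite mxE mulrC.
by move=> /eqP; rewrite addrC addr_eq0 => /eqP.
Qed.

End LineDerivatives.

(** * Inequalities for self-concordant barriers *)

Section Barrier.
Context {R : realType} {n : nat}.
Implicit Types (f : 'cV[R]_n -> R) (D K : set 'cV[R]_n) (x y d : 'cV[R]_n).

Lemma segment_mem D x y (s : R) : convex_set D -> D x -> D y ->
  0 <= s <= 1 -> D (x + s *: (y - x)).
Proof.
move=> cD Dx Dy /andP[s0 s1].
have := cD y x (Itv01 s0 s1); rewrite !inE => /(_ Dy Dx).
congr (D _); rewrite /conv /= scalerBr scalerBl scale1r.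
by rewrite addrCA.
Qed.

(** The continuous map [w => 2 *: w - y] sends the midpoint to [x], so it sends nearby [w] into [K];
    each such [w] is then a midpoint of two points of [K]. *)
Lemma midpoint_interior K x y : convex_set K -> K° x -> K y ->
  K° (x + 2^-1 *: (y - x)).
Proof.
move=> cK Kx Ky; set z := x + _.
have : {for z, continuous (fun w : 'cV[R]_n => 2 *: w - y)}.
  by apply: continuousB; [exact: scaler_continuous|move=> ?; exact: cst_continuous].
have zE : 2 *: z - y = x.
  by apply/matrixP => i j; rewrite !mxE; field.
move=> /(_ K); rewrite zE => /(_ Kx) Kz; rewrite /interior.
apply: (@filterS _ (nbhs z) _ _ _ _ Kz) => w /= Kw.
have -> : w = (2 *: w - y) + 2^-1 *: (y - (2 *: w - y)).
  by apply/matrixP => i j; rewrite !mxE; field.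
by apply: segment_mem => //; lra.
Qed.

Lemma sqr_local_norm f D x d : self_concordant f D -> D x ->
  local_norm f x d ^+ 2 = bform (hessian f x) d d.
Proof. by case=> _ _ _ Hpd _ Dx; rewrite sqr_sqrtr// posdef_ge0//; exact: Hpd. Qed.

Lemma local_normZ f x d (s : R) : local_norm f x (s *: d) = `|s| * local_norm f x d.
Proof.
rewrite /local_norm -/(bform _ _ _) bformZ sqrtrM ?sqr_ge0//.
by rewrite sqrtr_sqr.
Qed.

(* Cauchy-Schwarz in the local inner product, as g = H (H^-1 g). *)
Lemma barrier_gradient_bound f D (theta : R) x d : sc_barrier theta f D -> D x ->
  dotv (gradient f x) d ^+ 2 <= theta * bform (hessian f x) d d.
Proof.
move=> [fsc fth] Dx; have Hpd : posdef (hessian f x) by case: fsc => _ _ _ + _; exact.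
set u := invmx (hessian f x) *m gradient f x.
have -> : dotv (gradient f x) d = bform (hessian f x) u d.
  rewrite dotvE /bform /u trmx_mul trmx_inv (proj1 Hpd) -(mulmxA _ (invmx _)).
  by rewrite mulVmx ?mulmx1//; exact: posdef_unitmx.
apply: (le_trans (posdef_cauchy_schwarz _ _ Hpd)).
apply: ler_wpM2r; first exact: posdef_ge0.
rewrite -(@sqr_local_norm _ D)// -lee_fin; apply: le_trans fth.
by apply: ereal_sup_ubound; exists x.
Qed.

(* If a = psi 0 > 0 then psi' >= psi^2 / theta gives 1/a - 1/psi(1) >= 1/theta. *)
Lemma barrier_dot_le f D (theta : R) x y : 0 < theta -> sc_barrier theta f D ->
  D x -> D y -> dotv (gradient f x) (y - x) <= theta.
Proof.
move=> th0 fbar Dx Dy; have [[oD cD fC2 Hpd _] _] := fbar.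
set d := y - x; pose psi (s : R) := dotv (gradient f (x + s *: d)) d.
pose dpsi (s : R) := bform (hessian f (x + s *: d)) d d.
have Dline (s : R) : 0 <= s <= 1 -> D (x + s *: d) by exact: segment_mem.
have psi' (s : R) : 0 <= s <= 1 -> is_derive s 1 psi (dpsi s).
  by move=> s01; apply: (@is_derive_gradient_line _ _ f D) => //; exact: Dline.
have dpsi0 (s : R) : 0 <= s <= 1 -> 0 <= dpsi s.
  by move=> /Dline Ds; apply: posdef_ge0; exact: Hpd.
have psi0E : psi 0 = dotv (gradient f x) d by rewrite /psi scale0r addr0.
rewrite -psi0E leNgt; apply/negP => psi0.
(* Convexity of [f] makes [psi] nondecreasing on [0, 1]; it stays positive there, so its inverse
   [chi] is well defined. *)
have psi_ge (s : R) : 0 <= s <= 1 -> psi 0 <= psi s.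
  move=> /andP[s0 s1]; have [->//|sn0] := eqVneq s 0.
  have s0' : 0 < s by rewrite lt_neqAle eq_sym sn0.
  have [r||r] := @MVT R psi dpsi 0 s s0'.
  - by rewrite in_itv/= => /andP[? ?]; apply: psi'; lra.
  - apply: derivable_within_continuous => r; rewrite in_itv/= => /andP[? ?].
    by have [] : is_derive r 1 psi (dpsi r) by apply: psi'; lra.
  - rewrite in_itv/= => /andP[? ?] E; rewrite -subr_ge0 E mulr_ge0 ?subr_ge0 ?(ltW s0')//.
    by apply: dpsi0; lra.
have psi_gt0 (s : R) : 0 <= s <= 1 -> 0 < psi s.
  by move=> /psi_ge; apply: lt_le_trans; exact: lt_trans psi0.
pose chi (s : R) := (psi s)^-1.
have chi' (s : R) : 0 <= s <= 1 -> is_derive s 1 chi (- psi s ^- 2 *: dpsi s).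
  by move=> s01; apply: is_deriveV; [rewrite gt_eqF// psi_gt0|exact: psi'].
have [r||r] := @MVT R chi (fun s => - psi s ^- 2 *: dpsi s) 0 1 ltr01.
- by rewrite in_itv/= => /andP[? ?]; apply: chi'; lra.
- apply: derivable_within_continuous => r; rewrite in_itv/= => /andP[? ?].
  by have [] : is_derive r 1 chi (- psi r ^- 2 *: dpsi r) by apply: chi'; lra.
rewrite in_itv/= => /andP[r0 r1]; rewrite subr0 mulr1 => E.
have r01 : 0 <= r <= 1 by lra.
have : theta^-1 <= psi r ^- 2 * dpsi r.
  rewrite mulrC ler_pdivlMr ?exprn_gt0 ?psi_gt0// mulrC ler_pdivrMr// mulrC.
  by apply: (@barrier_gradient_bound _ D); [|exact: Dline].
(* [chi] starts below 1/theta and drops by at least 1/theta, yet ends positive: a contradiction. *)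
have : chi 1 > 0 by rewrite invr_gt0 psi_gt0//; lra.
have : chi 0 < theta^-1 by rewrite ltf_pV2 ?posrE// (lt_trans th0).
have : chi 1 - chi 0 = - (psi r ^- 2 * dpsi r) by rewrite E -mulNr.
by lra.
Qed.

(* With r the local norm of y - x, the Hessian along y - x stays above r^2 / 4 up
   to time 1/(2r), so there the slope of f is at least r / 8 - M; the bound
   theta on the remaining part of the segment limits r. *)
Lemma barrier_local_norm_le f D (theta M : R) x y : 0 < theta ->
  sc_barrier theta f D -> D x -> D y -> 0 <= M ->
  - M <= dotv (gradient f x) (y - x) ->
  local_norm f x (y - x) <= 1 + 8 * (M + 2 * theta).
Proof.
move=> th0 fbar Dx Dy M0 gM; have [fsc _] := fbar.
have [oD cD fC2 Hpd floc] := fsc.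
set d := y - x; set r := local_norm f x d.
have [r1|r1] := leP r 1; first by rewrite (le_trans r1)//; lra.
set s := (2 * r)^-1.
have r0 : 0 < r by lra.
have sr : s * r = 2^-1 by rewrite /s; field; lra.
have s0 : 0 < s by rewrite invr_gt0; lra.
have s12 : s < 2^-1 by nra.
pose psi (s : R) := dotv (gradient f (x + s *: d)) d.
pose dpsi (s : R) := bform (hessian f (x + s *: d)) d d.
have Dline (q : R) : 0 <= q <= 1 -> D (x + q *: d) by exact: segment_mem.
have psi' (q : R) : 0 <= q <= 1 -> is_derive q 1 psi (dpsi q).
  by move=> q01; apply: (@is_derive_gradient_line _ _ f D) => //; exact: Dline.
have [q||q] := @MVT R psi dpsi 0 s s0.
- by rewrite in_itv/= => /andP[? ?]; apply: psi'; lra.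
- apply: derivable_within_continuous => q; rewrite in_itv/= => /andP[? ?].
  by have [] : is_derive q 1 psi (dpsi q) by apply: psi'; lra.
rewrite in_itv/= subr0 => /andP[q0 qs] E.
have q01 : 0 <= q <= 1 by lra.
have d0 : d != 0.
  apply/eqP => d0; move: r0.
  by rewrite /r d0 /local_norm mulmx0 mxE sqrtr0 ltxx.
(* At local distance q r < 1/2 from [x], self-concordance shrinks the norm of [d] by a factor of at
   least 1/2. *)
have dq : r / 2 <= local_norm f (x + q *: d) d.
  have [_ /(_ (x + q *: d) d)] := floc x Dx.
  have nq : local_norm f x (q *: d) = q * r by rewrite local_normZ gtr0_norm.
  have nq' : local_norm f x (x - (x + q *: d)) = q * r.
    by rewrite opprD addNKr -scaleNr local_normZ normrN gtr0_norm.
  rewrite /local_ball /= nq' addrAC subrr add0r nq.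
  have qr : q * r < 2^-1 by rewrite -sr ltr_pM2r.
  move=> /(_ _ d0)/andP[|+ _]; first by lra.
  rewrite -/r (ler_pdivlMr _ _ r0) => H; apply: (le_trans _ H).
  by rewrite mulrC (ler_pM2r r0); lra.
have dpsiq : r ^+ 2 / 4 <= dpsi q.
  rewrite /dpsi -(@sqr_local_norm _ D)//; last exact: Dline.
  have -> : r ^+ 2 / 4 = (r / 2) ^+ 2 by field.
  have r2 : 0 <= r / 2 by lra.
  by apply: (lerXn2r _ _ _ dq); rewrite nnegrE ?r2 ?sqrtr_ge0.
(* The remaining segment to [y] is [(1 - s) *: d] with 1 - s > 1/2, hence the factor 2. *)
have psis : psi s <= 2 * theta.
  have := barrier_dot_le th0 fbar (Dline s _) Dy.
  have -> : y - (x + s *: d) = (1 - s) *: d.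
    by rewrite scalerBl scale1r opprD addrA.
  rewrite dotvZ -/(psi s) => /(_ _); have H : 0 <= s <= 1 by lra.
  move=> /(_ H) H1; have [|psi0] := leP (psi s) 0; first by lra.
  have : 0 <= (2^-1 - s) * psi s by rewrite mulr_ge0 ?subr_ge0// ltW.
  by lra.
have psi0 : psi 0 = dotv (gradient f x) d by rewrite /psi scale0r addr0.
have : r / 8 <= dpsi q * s.
  have -> : r / 8 = (r ^+ 2 / 4) * s by rewrite /s; field; lra.
  by apply: ler_wpM2r => //; exact: ltW.
by move: gM; rewrite -/d -psi0; lra.
Qed.

Lemma barrier_coord_le f D (theta M : R) x y : 0 < theta ->
  sc_barrier theta f D -> D `<=` nonneg_orthant -> D x -> D y -> 0 <= M ->
  - M <= dotv (gradient f x) (y - x) ->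
  forall i, y i ord0 <= (3 + 8 * (M + 2 * theta)) * x i ord0.
Proof.
move=> th0 fbar Dpos Dx Dy M0 gM i.
have := barrier_local_norm_le th0 fbar Dx Dy M0 gM.
set r := local_norm f x (y - x); set B := 8 * (M + 2 * theta) => rB.
have B0 : 0 <= B by rewrite /B; lra.
have [[_ _ _ _ /(_ x Dx)[Bx _]] _] := fbar.
(* Moving from [x] away from [y] by 1/(2 + B) has local length at most (1 + B)/(2 + B) < 1, so the
   point reached is in [D] and has nonnegative coordinates. *)
have /Bx/Dpos/(_ i) : local_ball f x x 1 (x - (2 + B)^-1 *: (y - x)).
  rewrite /local_ball /= opprB addrCA subrr addr0 local_normZ ger0_norm ?invr_ge0; last lra.
  by rewrite mulrC ltr_pdivrMr ?mul1r -/r; lra.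
rewrite !mxE; set s := (2 + B)^-1 => H.
have : (2 + B) * (x i ord0 - s * (y i ord0 - x i ord0)) >= 0 by apply: mulr_ge0; lra.
have -> : (2 + B) * (x i ord0 - s * (y i ord0 - x i ord0)) =
   (3 + B) * x i ord0 - y i ord0 by rewrite /s; field; lra.
by rewrite subr_ge0.
Qed.

End Barrier.

(** * Bounds on points of the central path *)

Section CentralPath.
Context {R : realType} {n : nat}.
Implicit Types (f : 'cV[R]_n -> R) (K : set 'cV[R]_n) (c x y : 'cV[R]_n).

Lemma sc_barrier_le f K (theta theta' : R) : theta <= theta' ->
  sc_barrier theta f K -> sc_barrier theta' f K.
Proof.
by move=> thth' [fsc fth]; split => //; apply: le_trans fth _; rewrite lee_fin.
Qed.

Lemma scale_mem K y (s : R) : convex_set K -> K 0 -> K y -> 0 <= s <= 1 ->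
  K (s *: y).
Proof.
by move=> cK K0 Ky s01; have := segment_mem cK K0 Ky s01; rewrite subr0 add0r.
Qed.

Section Bounds.
Variables (theta eta : R) (f : 'cV[R]_n -> R) (K : set 'cV[R]_n) (c x : 'cV[R]_n).
Hypotheses (theta_gt0 : 0 < theta) (eta_gt0 : 0 < eta).
Hypotheses (convexK : convex_set K) (K0 : K 0) (Kpos : K `<=` nonneg_orthant).
Hypothesis c_pos : nonneg_orthant c.
Hypothesis f_barrier : sc_barrier theta f K°.
Hypothesis x_min : minimizer (fun y => eta * dotv c y + f y) K° x.

(* The barrier only controls interior points: a point of K is replaced by its
   midpoint with x. *)
Let mid y := x + 2^-1 *: (y - x).

Let mid_interior y : K y -> K° (mid y).
Proof. by apply: midpoint_interior => //; case: x_min. Qed.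

Let gradient_mid y :
  dotv (gradient f x) (mid y - x) = eta * (dotv c x - dotv c y) / 2.
Proof.
rewrite /mid addrAC subrr add0r.
have [[oD _ fC2 _ _] _] := f_barrier.
rewrite (interior_minimizer_gradient oD fC2 x_min).
by rewrite dotvZ dotvD dotvN; field.
Qed.

(** The gradient bound towards the midpoint of [x] and 0; the midpoint accounts for the factor 2. *)
Lemma central_path_cost_le : eta * dotv c x <= 2 * theta.
Proof.
have [Kx _] := x_min.
have := barrier_dot_le theta_gt0 f_barrier Kx (mid_interior K0).
rewrite gradient_mid; have -> : dotv c (0 : 'cV[R]_n) = 0.
  by rewrite dotvE mulmx0 mxE.
by rewrite subr0; lra.
Qed.

(** The cost bound on [y] makes the slope at [x] towards the midpoint at least -1/2, so the
    coordinate bound applies with M = 1. As x >= 0, the midpoint dominates y/2, hence the factor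
    2. *)
Lemma central_path_coord_ge y i : K y -> eta * dotv c y <= 1 ->
  y i ord0 <= 2 * (3 + 8 * (1 + 2 * theta)) * x i ord0.
Proof.
move=> Ky cy; have [Kx _] := x_min.
have Kpos' : K° `<=` nonneg_orthant by apply: subset_trans Kpos; exact: interior_subset.
have x0 := Kpos' x Kx i; have x0c : 0 <= eta * dotv c x.
  by apply: mulr_ge0; [exact: ltW|apply: dotv_ge0 => //; exact: Kpos'].
have := barrier_coord_le theta_gt0 f_barrier Kpos' Kx (mid_interior Ky) ler01.
rewrite gradient_mid => /(_ _ i) H.
have {}H := H ltac:(lra); move: H; rewrite !mxE.
by move: x0; set B := 3 + _; lra.
Qed.

End Bounds.
End CentralPath.

(** * From multiplicative to additive estimates under the extended logarithm *)

Section Logarithms.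
Context {R : realType}.
Implicit Types (a b e l L M : R) (u v : \bar R).

(** An entry of [logt t], with [L] standing for [ln t]. *)
Let lnt L a : \bar R := (lne a%:E * (L^-1)%:E)%E.

Let lnt_Ny L a : 0 < L -> a <= 0 -> lnt L a = -oo%E.
Proof.
by move=> L0 a0; rewrite /lnt le0_lneNy ?lee_fin// mulNyr gtr0_sg ?invr_gt0// mul1e.
Qed.

Let lnt_fin L a : 0 < a -> lnt L a = (ln a / L)%:E.
Proof. by move=> a0; rewrite /lnt lne_EFin. Qed.

Lemma lnt_le L M a b : 0 < L -> a <= expR M * b ->
  (lne a%:E * (L^-1)%:E <= lne b%:E * (L^-1)%:E + (M / L)%:E)%E.
Proof.
move=> L0 ab; rewrite -/(lnt L a) -/(lnt L b).
have [a0|a0] := leP a 0; first by rewrite lnt_Ny// leNye.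
have b0 : 0 < b by rewrite -(pmulr_rgt0 _ (expR_gt0 M)) (lt_le_trans a0).
rewrite !lnt_fin// -EFinD lee_fin -mulrDl ler_pM2r ?invr_gt0// addrC.
by rewrite -(expRK M) -lnM ?posrE ?expR_gt0// ler_ln ?posrE ?mulr_gt0 ?expR_gt0.
Qed.

(** Carries the cost constraint, one coordinate at a time, from the real to the tropical side. The
    product bound absorbs an error [e] on each of the two factors; a zero factor makes the tropical
    sum -oo. *)
Lemma lnt_add_le L e l a b u v : 0 < L -> 0 <= a -> 0 <= b ->
  (u <= lne a%:E * (L^-1)%:E + e%:E)%E -> (v <= lne b%:E * (L^-1)%:E + e%:E)%E ->
  a * b <= expR (- (l * L) - 2 * (e * L)) -> (u + v <= (- l)%:E)%E.
Proof.
move=> L0 a0 b0; rewrite -/(lnt L a) -/(lnt L b) => ua vb ab.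
move: a0; rewrite le_eqVlt => /predU1P[a0|a0].
  by move: ua; rewrite lnt_Ny -?a0// addNye leeNy_eq => /eqP ->; rewrite addNye leNye.
move: b0; rewrite le_eqVlt => /predU1P[b0|b0].
  by move: vb; rewrite lnt_Ny -?b0// addNye leeNy_eq => /eqP ->; rewrite addeNy leNye.
move: ua vb; rewrite !lnt_fin// -!EFinD => ua vb.
apply: (le_trans (leeD ua vb)); rewrite -EFinD lee_fin.
have : ln a + ln b <= - (l * L) - 2 * (e * L).
  by rewrite -lnM ?posrE// -ler_expR lnK ?posrE ?mulr_gt0.
move=> H; rewrite -(ler_pM2r L0).
have -> : (ln a / L + e + (ln b / L + e)) * L = ln a + ln b + 2 * (e * L).
  by field; lra.
by lra.
Qed.

(** The transfer in the other direction, from a tropical constraint to a bound on a product; here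
    the two errors weaken the bound. *)
Lemma lnt_mul_le L e l a b u v : 0 < L -> 0 <= a -> 0 <= b ->
  (lne a%:E * (L^-1)%:E - e%:E <= u)%E -> (lne b%:E * (L^-1)%:E - e%:E <= v)%E ->
  (u + v <= (- l)%:E)%E -> a * b <= expR (- (l * L) + 2 * (e * L)).
Proof.
move=> L0 a0 b0; rewrite -/(lnt L a) -/(lnt L b) => ua vb uv.
move: a0; rewrite le_eqVlt => /predU1P[<-|a0]; first by rewrite mul0r expR_ge0.
move: b0; rewrite le_eqVlt => /predU1P[<-|b0]; first by rewrite mulr0 expR_ge0.
have := le_trans (leeD ua vb) uv; rewrite !lnt_fin// -!EFinB -EFinD lee_fin.
rewrite -(ler_pM2r L0).
have -> : (ln a / L - e + (ln b / L - e)) * L = ln a + ln b - 2 * (e * L).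
  by field; lra.
move=> H; rewrite -[leLHS]lnK ?posrE ?mulr_gt0// ler_expR lnM ?posrE//.
by lra.
Qed.

End Logarithms.

Lemma lee_trans_shift {R : realType} (u v w : \bar R) (p q r : R) :
  (u <= v + p%:E)%E -> (v <= w + q%:E)%E -> p + q <= r -> (u <= w + r%:E)%E.
Proof.
move=> uv vw pqr; apply: (le_trans uv); apply: (le_trans (leeD2r p%:E vw)).
by rewrite -addeA leeD// -EFinD lee_fin addrC.
Qed.

(** * Witnesses for the tropical distances *)

Section Distances.
Context {R : realType} {n : nat}.
Implicit Types (u v : 'cV[\bar R]_n) (U V : set 'cV[\bar R]_n).

Lemma dinf_le u v (e : R) : 0 <= e ->
  (forall i, (u i ord0 - e%:E <= v i ord0)%E /\ (v i ord0 <= u i ord0 + e%:E)%E) ->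
  (dinf u v <= e%:E)%E.
Proof. by move=> e0 uv; apply: ereal_inf_lbound; exists e. Qed.

(** A strict bound on the infimum provides an admissible [l] below [e], without any question of
    attainment. *)
Lemma dinf_lt u v (e : R) i : (dinf u v < e%:E)%E ->
  (u i ord0 - e%:E <= v i ord0)%E /\ (v i ord0 <= u i ord0 + e%:E)%E.
Proof.
move=> /ereal_inf_lt[_ [l [l0 /(_ i)[uv vu]] <-]]; rewrite lte_fin => /ltW le.
split; first by apply: le_trans uv; rewrite leeB// lee_fin.
by apply: (le_trans vu); rewrite leeD// lee_fin.
Qed.

Lemma dinf_set_ltl U V (e : R) u : (dinf_set U V < e%:E)%E -> U u ->
  exists2 v, V v & (dinf u v < e%:E)%E.
Proof.
rewrite /dinf_set gt_max => /andP[UV _] Uu.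
have : (ereal_inf [set dinf u v | v in V] < e%:E)%E.
  by apply: le_lt_trans UV; apply: ereal_sup_ubound; exists u.
by move=> /ereal_inf_lt[_ [v Vv <-] ?]; exists v.
Qed.

Lemma dinf_set_ltr U V (e : R) v : (dinf_set U V < e%:E)%E -> V v ->
  exists2 u, U u & (dinf u v < e%:E)%E.
Proof.
rewrite /dinf_set gt_max => /andP[_ VU] Vv.
have : (ereal_inf [set dinf u v | u in U] < e%:E)%E.
  by apply: le_lt_trans VU; apply: ereal_sup_ubound; exists v.
by move=> /ereal_inf_lt[_ [u Uu <-] ?]; exists u.
Qed.

Lemma tropical_dot_leP u v (l : R) :
  (tropical_dot u v <= l%:E)%E <-> forall i, (u i ord0 + v i ord0 <= l%:E)%E.
Proof.
split=> [H i|H]; last by apply: bigmax_le => [|i _]; [exact: leNye|exact: H].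
apply: le_trans H.
by rewrite /tropical_dot; exact: (le_bigmax _ (fun i => u i ord0 + v i ord0)%E i).
Qed.

End Distances.

(** * Uniform convergence to the tropical central path *)

Theorem theorem11 (R : realType) (n : nat) (theta deltastar : R)
    (K : set 'cV[\bar R]_n)
    (deltastar_gt0 : 0 < deltastar)
    (K_sub : K `<=` tropical_space)
    (K_regular : tropical_regular K)
    (K_semilinear : semilinear_set (real_part K)) :
  exists Gamma : R, 0 < Gamma /\
  forall (Kt : R -> set 'cV[R]_n) (ct : R -> 'cV[R]_n)
    (ft : R -> 'cV[R]_n -> R) (C : R -> R -> 'cV[R]_n) (c : 'cV[\bar R]_n),
  convex_programs Kt ct ->
  (forall t : R, 1 < t -> sc_barrier theta (ft t) (Kt t)°) ->
  central_path Kt ct ft C ->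
  tropical_space c ->
  bigO_inv_log (fun t => dinf_set (logt t @` Kt t) K) ->
  bigO_inv_log (fun t => dinf (logt t (ct t)) c) ->
  (forall t : R, 1 < t ->
     (maxe (dinf_set (logt t @` Kt t) K) (dinf (logt t (ct t)) c) * (ln t)%:E
      <= deltastar%:E)%E) ->
  (forall lambda : R, bounded_from_above (tropical_sublevel K c lambda)) ->
  (forall eps : R, 0 < eps -> \forall t \near +oo, forall lambda : R,
     (dinf (logt t (C t (t `^ lambda)%R)) (tropical_central_path K c lambda)
      <= eps%:E)%E) /\
  (exists t0 : R, 0 < t0 /\ forall t : R, 1 < t -> t0 <= t -> forall lambda : R,
     (dinf (logt t (C t (t `^ lambda)%R)) (tropical_central_path K c lambda)
      <= (Gamma / ln t)%:E)%E).
Proof.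
(* Enlarging theta to at least 1 makes it positive, as the barrier bounds require, and makes ln (2
   theta') positive. *)
pose theta' := Num.max theta 1.
have th1 : 1 <= theta' by rewrite le_max lexx orbT.
have th0 : 0 < theta' by lra.
(* Doubling [deltastar] turns the distance bounds into strict ones, so that nearby points can be
   extracted from the infima. *)
pose E := 2 * deltastar; have E0 : 0 < E by rewrite mulr_gt0.
(* Scaling the central point by exp(-m) offsets the cost bound 2 theta' and the errors on cost and
   point. *)
pose m := ln (2 * theta') + 2 * E.
have m0 : 0 < m by rewrite addr_gt0 ?ln_gt0 ?mulr_gt0//; lra.
pose A := 2 * (3 + 8 * (1 + 2 * theta')).
have A1 : 1 < A by rewrite /A; lra.
have lnA0 : 0 < ln A by rewrite ln_gt0.
(* Scaling by exp(-p) offsets the same two errors and the summation of [n] products; n + 1 keeps the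
   logarithm meaningful when n = 0. *)
pose p := 2 * E + ln n.+1%:R.
have lnn0 : 0 <= ln (n.+1%:R : R) by rewrite ln_ge0// ler1n.
have p0 : 0 < p by rewrite ltr_pwDl// mulr_gt0.
(* The two inequalities lose m + E and p + ln A + E respectively; [Gamma] dominates both. *)
pose Gamma := m + p + ln A + E.
have G0 : 0 < Gamma by rewrite /Gamma; lra.
exists Gamma; split => // Kt ct ft C c hK hf hC _ _ _ hdelta _.
(* The bound will hold for every t > 1, so [t0] can be 1; uniform convergence follows as soon as t
   >= exp(Gamma / eps). *)
suff main (t lambda : R) : 1 < t ->
    (dinf (logt t (C t (t `^ lambda)%R)) (tropical_central_path K c lambda)
      <= (Gamma / ln t)%:E)%E.
  split; last by exists 1; split => // t t1 _ lambda; exact: main.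
  move=> eps eps0; near=> t => lambda.
  have t1 : 1 < t by near: t; exact: nbhs_pinfty_gt.
  apply: (le_trans (main t lambda t1)).
  rewrite lee_fin ler_pdivrMr ?ln_gt0// mulrC -ler_pdivrMr// -ler_expR lnK.
    by near: t; exact: nbhs_pinfty_ge.
  by rewrite posrE; lra.
move=> t1; have [_ cK _ K0 [Kpos cpos]] := hK t t1.
set L := ln t; have L0 : 0 < L by rewrite /L ln_gt0.
set e := E / L; have eL : e * L = E by rewrite /e divfK// gt_eqF.
have e0 : 0 < e by rewrite divr_gt0.
have : (maxe (dinf_set (logt t @` Kt t) K) (dinf (logt t (ct t)) c) < e%:E)%E.
  apply: (@le_lt_trans _ _ (deltastar / L)%:E).
    by rewrite EFinM lee_pdivlMr// hdelta.
  by rewrite lte_fin ltr_pM2r ?invr_gt0// /E; lra.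
rewrite gt_max => /andP[dK dc].
set eta := t `^ lambda; have etaE : eta = expR (lambda * L).
  by rewrite /eta /powR gt_eqF//; lra.
have eta0 : 0 < eta by rewrite etaE expR_gt0.
set x := C t eta; have [xmin _] := hC t eta t1 eta0.
have Kx : Kt t x by case: xmin => /interior_subset.
have hf' : sc_barrier theta' (ft t) (Kt t)°.
  by apply: (@sc_barrier_le _ _ _ _ theta) (hf t t1); rewrite le_max lexx.
have costx := central_path_cost_le th0 cK K0 hf' xmin.
have coordx := central_path_coord_ge th0 eta0 cK Kpos cpos hf' xmin.
have cmul y i : nonneg_orthant y -> ct t i ord0 * y i ord0 <= dotv (ct t) y.
  move=> ypos; rewrite /dotv (bigD1 i)//= lerDl sumr_ge0// => j _.
  by rewrite mulr_ge0.
apply: dinf_le => [|i]; first by rewrite divr_ge0// ltW.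
rewrite !mxE; split.
(* Lower side: the scaled central point lies near a point [k] of the tropical sublevel set, and [k]
   is below the barycenter. *)
- pose y := expR (- m) *: x.
  have Ky : Kt t y.
    by apply: scale_mem => //; rewrite expR_ge0 -expR0 ler_expR oppr_le0 ltW.
  have ypos := Kpos y Ky.
  have [k Kk dk] := dinf_set_ltl dK (ex_intro2 _ _ y Ky erefl).
  have Kk' : tropical_sublevel K c lambda k.
    split => //; apply/tropical_dot_leP => j.
    have [_ cj] := dinf_lt j dc; have [_ kj] := dinf_lt j dk.
    rewrite mxE in cj; rewrite mxE in kj.
    apply: (lnt_add_le L0 (cpos j) (ypos j) cj kj).
    have := cmul y j ypos; move=> /le_trans; apply.
    rewrite /y dotvZ.
    have : dotv (ct t) x <= 2 * theta' / eta by rewrite ler_pdivlMr// mulrC.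
    move=> /(ler_wpM2l (expR_ge0 (- m)))/le_trans; apply.
    rewrite etaE -expRN -[2 * theta']lnK ?posrE ?mulr_gt0// -!expRD ler_expR.
    by rewrite /m eL; lra.
  apply: (@le_trans _ _ (k i ord0)); last first.
    by apply: ereal_sup_ubound; exists k.
  have [ki _] := dinf_lt i dk; rewrite mxE in ki.
  have xy : (lne (x i ord0)%:E * (L^-1)%:E <= lne (y i ord0)%:E * (L^-1)%:E + (m / L)%:E)%E.
    by apply: lnt_le => //; rewrite /y mxE mulrA -expRD subrr expR0 mul1r.
  rewrite leeBlDr//; rewrite leeBlDr// in ki.
  apply: (lee_trans_shift xy ki).
  by rewrite /e -mulrDl ler_pM2r ?invr_gt0// /Gamma; lra.
(* Upper side: each [k] in the sublevel set is near the logarithm of some [z] in [Kt t], and [z]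
   scaled by exp(-p) costs at most 1/eta, so it is dominated by [A] times the central point. *)
- apply: ge_ereal_sup => _ [k [Kk /tropical_dot_leP ck] <-].
  have [_ [z Kz <-] dz] := dinf_set_ltr dK Kk.
  have zpos := Kpos z Kz.
  pose y := expR (- p) *: z.
  have Ky : Kt t y.
    by apply: scale_mem => //; rewrite expR_ge0 -expR0 ler_expR oppr_le0 ltW.
  have cz : dotv (ct t) z <= n%:R * expR (- (lambda * L) + 2 * E).
    rewrite -[n in n%:R]card_ord mulr_natl -sumr_const; apply: ler_sum => j _.
    have [cj _] := dinf_lt j dc; have [kj _] := dinf_lt j dz.
    rewrite mxE in cj; rewrite mxE in kj; rewrite -eL.
    exact: (lnt_mul_le L0 (cpos j) (zpos j) cj kj (ck j)).
  have cy : eta * dotv (ct t) y <= 1.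
    rewrite /y dotvZ mulrA etaE -expRD.
    apply: (le_trans (ler_wpM2l (expR_ge0 _) cz)).
    rewrite mulrCA -expRD -[n%:R * _]mulrC.
    have -> : lambda * L - p + (- (lambda * L) + 2 * E) = - ln n.+1%:R.
      by rewrite /p; ring.
    by rewrite expRN lnK ?posrE ?ltr0n// mulrC ler_pdivrMr ?ltr0n// mul1r ler_nat.
  have yx := coordx _ i Ky cy.
  have [_ ki] := dinf_lt i dz; rewrite mxE in ki.
  have zx : (lne (z i ord0)%:E * (L^-1)%:E <= lne (x i ord0)%:E * (L^-1)%:E + ((p + ln A) / L)%:E)%E.
    apply: lnt_le => //.
    rewrite expRD lnK ?posrE; last by lra.
    by rewrite -mulrA -ler_pdivrMl ?expR_gt0// -expRN; move: yx; rewrite /y mxE.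
  apply: (lee_trans_shift ki zx).
  by rewrite /e -mulrDl ler_pM2r ?invr_gt0// /Gamma; lra.
Unshelve. all: by end_near. Qed.
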